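(* Let $X$ be a nonempty compact metric space and let $\phi$ be the semiflow of an impulsive dynamical system $(X,\varphi,D,I)$. If $\Omega_\phi\cap D=\emptyset$, then $\phi$ has some invariant probability measure.
   Context: A semiflow on a metric space $X$ is a map $\phi:\mathbb{R}^+_0\times X\to X$, $\phi_t(x)=\phi(t,x)$, with $\phi_0(x)=x$ and $\phi_{t+s}(x)=\phi_t(\phi_s(x))$ for all $x\in X$, $s,t\ge 0$ (not necessarily continuous). Non-wandering set: $x\in X$ is non-wandering for $\phi$ if for every neighborhood $U$ of $x$ and any $T>0$ there exists $t\ge T$ with $\phi_t^{-1}(U)\cap U\ne\emptyset$; $\Omega_\phi$ denotes the set of all non-wandering points. Impulsive dynamical system: let $\varphi:\mathbb{R}^+_0\times X\to X$ be a continuous semiflow, $D\subset X$ a compact set and $I:D\to X$ a continuous function. Put $\tau_1(x)=\inf\{t>0:\varphi_t(x)\in D\}$ if $\varphi_t(x)\in D$ for some $t>0$, and $\tau_1(x)=+\infty$ otherwise. Assume $\tau_1(x)>0$ for all $x\in X$. The impulsive trajectory $\gamma_x$ and impulsive times $\tau_n(x)$ of $x$ are defined by: $\gamma_x(t)=\varphi_t(x)$ for $0\le t<\tau_1(x)$; if $\tau_1(x)<\infty$, then $\gamma_x(\tau_1(x))=I(\varphi_{\tau_1(x)}(x))$; inductively, as long as $\tau_n(x)<\infty$, $\tau_{n+1}(x)=\tau_n(x)+\tau_1(\gamma_x(\tau_n(x)))$, $\gamma_x(t)=\varphi_{t-\tau_n(x)}(\gamma_x(\tau_n(x)))$ for $\tau_n(x)<t<\tau_{n+1}(x)$,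 and, if $\tau_{n+1}(x)<\infty$, $\gamma_x(\tau_{n+1}(x))=I(\varphi_{\tau_{n+1}(x)-\tau_n(x)}(\gamma_x(\tau_n(x))))$. Put $T(x)=\sup_{n\ge1}\tau_n(x)$ (the supremum over all impulsive times that are defined). The tuple $(X,\varphi,D,I)$ is an impulsive dynamical system if $\tau_1(x)>0$ and $T(x)=+\infty$ for all $x\in X$. Its (impulsive) semiflow is $\phi:\mathbb{R}^+_0\times X\to X$, $\phi(t,x)=\gamma_x(t)$; it is a semiflow, not necessarily continuous. Invariant measures: a Borel probability measure $\mu$ on $X$ is $\phi$-invariant if $\phi$ is Borel measurable and $\mu(\phi_t^{-1}(A))=\mu(A)$ for every Borel set $A\subset X$ and every $t\ge0$. *)

(* Defs.v *)
From HB Require Import structures.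
From mathcomp Require Import all_boot all_order all_algebra.
From mathcomp Require Import all_classical all_reals all_analysis.

Set Implicit Arguments.
Unset Strict Implicit.
Unset Printing Implicit Defensive.
Import Order.TTheory GRing.Theory Num.Theory.
Import numFieldNormedType.Exports.

Local Open Scope classical_set_scope.
Local Open Scope ring_scope.

(* Nonempty metric spaces; a base point is what the library requires of a
   carrier of measures. *)
#[short(type="pmetricType")]
HB.structure Definition PointedMetric (R : numDomainType) :=
  {M of Metric R M & isPointed M}.

Notation borelType T := (g_sigma_algebraType (@open T)).

Section Semiflow.
Context {R : realType} {X : pmetricType R}.

(* A map from [0, +oo[ * X to X is encoded as a function psi : R -> X -> X of
   which only the values psi t x with 0 <= t matter. *)
Implicit Types psi : R -> X -> X.

Definition time_domain : set (R * X) := [set p | 0 <= p.1].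

Record semiflow psi : Prop := {
  semiflow0 : forall x, psi 0 x = x ;
  semiflowD : forall s t x, 0 <= s -> 0 <= t ->
    psi (t + s) x = psi t (psi s x) }.

Record continuous_semiflow psi : Prop := {
  continuous_semiflow_semiflow : semiflow psi ;
  continuous_semiflow_continuous :
    {within time_domain, continuous (fun p : R * X => psi p.1 p.2)} }.

Definition nonwandering psi : set X :=
  [set x | forall U : set X, nbhs x U -> forall T : R, 0 < T ->
    exists t : R, T <= t /\ (psi t @^-1` U) `&` U !=set0].

(* Measurability on [0, +oo[ * X is for the Borel sets of the product
   topology. *)
Definition borel_measurable_semiflow psi : Prop :=
  measurable_fun (time_domain : set (borelType (R * X)%type))
    ((fun p => psi p.1 p.2) : borelType (R * X)%type -> borelType X).

Definition invariant_measure psi (mu : probability (borelType X) R) : Prop :=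
  borel_measurable_semiflow psi /\
  forall (A : set (borelType X)) (t : R), measurable A -> 0 <= t ->
    mu (psi t @^-1` A) = mu A.

End Semiflow.

Section Impulsive.
Context {R : realType} {X : pmetricType R}.

(* The impulse map is given by a function I on the whole of X; its values
   outside D are irrelevant. *)
Variables (phi : R -> X -> X) (D : set X) (I : X -> X).

(* +oo when the orbit of x never meets D at a positive time. *)
Definition hitting_time (x : X) : \bar R :=
  ereal_inf [set t%:E | t in [set t : R | 0 < t /\ D (phi t x)]].

(* The position at the n-th impulsive time, that of time 0 being x itself;
   it is meaningful only when that time is finite. *)
Fixpoint impulse_point (n : nat) (x : X) : X :=
  if n is m.+1 then
    let y := impulse_point m x in I (phi (fine (hitting_time y)) y)
  else x.

(* The n-th impulsive time for n >= 1, and 0 for n = 0; once an impulsive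
   time is +oo, so are all the following ones, instead of being undefined. *)
Fixpoint impulse_time (n : nat) (x : X) : \bar R :=
  (if n is m.+1 then impulse_time m x + hitting_time (impulse_point m x)
   else 0)%E.

(* Under the assumptions of impulsive_system there is, for 0 <= t, exactly one
   n with impulse_time n x <= t < impulse_time n.+1 x. At t = impulse_time n x
   the value is phi 0 (impulse_point n x) = impulse_point n x. *)
Definition impulsive_semiflow (t : R) (x : X) : X :=
  xget x [set phi (t - fine (impulse_time n x)) (impulse_point n x) |
    n in [set n | (impulse_time n x <= t%:E < impulse_time n.+1 x)%E]].

Record impulsive_system : Prop := {
  impulsive_continuous_semiflow : continuous_semiflow phi ;
  impulsive_compact : compact D ;
  impulsive_continuous : {within D, continuous I} ;
  impulsive_hitting_time_gt0 : forall x, (0 < hitting_time x)%E ;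
  impulsive_time_sup : forall x,
    ereal_sup (range (fun n => impulse_time n.+1 x)) = +oo%E }.

End Impulsive.

(* Main.v *)
Require Import Defs.
From HB Require Import structures.
From mathcomp Require Import all_boot all_order all_algebra.
From mathcomp Require Import all_classical all_reals all_analysis.
From mathcomp Require Import measurable_realfun ring.
Import Order.TTheory GRing.Theory Num.Theory.
Import numFieldNormedType.Exports.
Local Open Scope classical_set_scope.
Local Open Scope ring_scope.

(** The impulsive semiflow F is in general discontinuous, but every orbit of F
    ends up being an orbit of the continuous semiflow phi, and the classical
    averaging argument can be run on that orbit.

    A point d of D is wandering: it has a neighborhood U and a time T such that
    F never returns to U after a delay of T or more. By the semiflow law
    (impulsive_semiflowD) a given orbit of F that visits U is out of U for ever
    when the time T has passed, and as D is compact a tail of the orbit stays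
    out of an open W containing D (impulse_set_avoids_tail). An impulse at
    time r requires the left limit of the trajectory at r to lie in D, so that
    just before r the trajectory is in W. Hence there is no impulse in that
    tail: from some point z on, F coincides with phi, and the orbit of z under
    phi avoids W (orbit_avoiding_impulses).

    For a continuous semiflow on a compact space, an invariant probability is
    obtained from any orbit, without representing functionals by measures: the
    asymptotic fraction of the time that the orbit of z spends in a closed
    set C, computed along an ultrafilter, is a finitely additive set function
    that phi leaves invariant (sojourn_density_content, sojourn_density_flow),
    and Caratheodory's construction turns it into a Borel probability mu
    (closed_content_probability), still phi-invariant
    (orbit_invariant_probability). Open sets that the orbit of z never visits
    are mu-null. This applies to the union O of the phi t @^-1` W: outside O
    no orbit of phi meets D, so that F = phi there, and mu is F-invariant.

    It remains to see that F is Borel measurable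
    (impulsive_semiflow_measurable): between two consecutive impulses
    F t x is phi (t - time n x) (point n x), where the impulsive times and
    positions are Borel functions of x because the sets of points that hit D
    within a compact interval of times are closed. *)

(** * From a content on closed sets to a Borel probability *)

Section ContentMeasure.
Set Implicit Arguments.
Unset Strict Implicit.
Context {R : realType} {T : ptopologicalType}.
Hypothesis T_hausdorff : hausdorff_space T.
Hypothesis T_compact : compact [set: T].

(** Normality of compact Hausdorff spaces. This is what makes a content that is
    only subadditive on closed sets countably subadditive on open ones. *)
Lemma closed_split_openU (C U V : set T) :
  closed C -> open U -> open V -> C `<=` U `|` V ->
  exists C1 C2, [/\ closed C1, closed C2, C1 `<=` U, C2 `<=` V &
                    C = C1 `|` C2].
Proof.
move=> cC oU oV CUV.
have cU : closed (C `\` U) by apply: closedI => //; exact: open_closedC.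
have cV : closed (C `\` V) by apply: closedI => //; exact: open_closedC.
have UV0 : (C `\` U) `&` (C `\` V) = set0.
  by rewrite -subset0 => x [[Cx nUx] [_ nVx]]; case: (CUV x Cx).
have /(@normal_openP R) nT := compact_normal T_hausdorff T_compact.
have [U' [V' [oU' oV' CU' CV' U'V'0]]] := nT _ _ cU cV UV0.
exists (C `\` U'), (C `\` V'); split.
- by apply: closedI => //; exact: open_closedC.
- by apply: closedI => //; exact: open_closedC.
- by move=> x [Cx nU'x]; apply: contrapT => nUx; apply: nU'x; exact: CU'.
- by move=> x [Cx nV'x]; apply: contrapT => nVx; apply: nV'x; exact: CV'.
- rewrite -setDIr U'V'0 setD0//.
Qed.

Variable lam : set T -> R.

(** These are the properties of the restriction to closed sets of a finitely
    additive measure; subadditivity makes its extension an outer measure, and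
    superadditivity gives Caratheodory's criterion. *)
Record closed_content : Prop := {
  closed_content0 : lam set0 = 0 ;
  closed_content_le : forall C E, closed C -> closed E -> C `<=` E ->
    lam C <= lam E ;
  closed_contentU_le : forall C E, closed C -> closed E ->
    lam (C `|` E) <= lam C + lam E ;
  closed_contentU_ge : forall C E, closed C -> closed E -> C `&` E = set0 ->
    lam C + lam E <= lam (C `|` E) }.

Hypothesis lam_content : closed_content.

Local Open Scope ereal_scope.

Definition inner_content (U : set T) : \bar R :=
  ereal_sup [set (lam C)%:E | C in [set C | closed C /\ C `<=` U]].

Definition outer_content (A : set T) : \bar R :=
  ereal_inf [set inner_content U | U in [set U | open U /\ A `<=` U]].

Lemma inner_content_ge (C U : set T) : closed C -> C `<=` U ->
  (lam C)%:E <= inner_content U.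
Proof. by move=> cC CU; apply: ereal_sup_ubound; exists C. Qed.

Lemma inner_content_ge0 U : 0 <= inner_content U.
Proof.
rewrite -[leLHS]/(0%R%:E) -(closed_content0 lam_content) inner_content_ge//.
exact: closed0.
Qed.

Lemma le_inner_content (U V : set T) : U `<=` V ->
  inner_content U <= inner_content V.
Proof.
move=> UV; apply: ge_ereal_sup => _ [C [cC CU] <-].
by apply: inner_content_ge => //; exact: subset_trans UV.
Qed.

Lemma inner_contentT : inner_content setT = (lam setT)%:E.
Proof.
apply/eqP; rewrite eq_le inner_content_ge ?andbT//.
apply: ge_ereal_sup => _ [C [cC _] <-].
by rewrite lee_fin (closed_content_le lam_content).
Qed.

Lemma closed_content_le_sum (U : (set T)^nat) n C : (forall i, open (U i)) ->
  closed C -> C `<=` \bigcup_(i < n) U i ->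
  (lam C)%:E <= \sum_(i < n) inner_content (U i).
Proof.
move=> oU; elim: n C => [|n IHn] C cC.
  rewrite bigcup_mkord big_ord0 subset0 => ->.
  by rewrite closed_content0// big_ord0.
rewrite bigcup_mkord big_ord_recr/= -bigcup_mkord => CU.
have oUn : open (\bigcup_(i < n) U i) by exact: bigcup_open.
have [C1 [C2 [cC1 cC2 C1U C2U ->]]] := closed_split_openU cC oUn (oU n) CU.
rewrite big_ord_recr/=; apply: le_trans (leeD (IHn _ cC1 C1U)
  (inner_content_ge cC2 C2U)).
by rewrite -EFinD lee_fin (closed_contentU_le lam_content).
Qed.

(** A closed subset of a countable union of open sets is compact, hence covered
    by finitely many of them. *)
Lemma inner_content_sigma_subadditive (U : (set T)^nat) :
  (forall i, open (U i)) ->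
  inner_content (\bigcup_i U i) <= \sum_(i <oo) inner_content (U i).
Proof.
move=> oU; apply: ge_ereal_sup => _ [C [cC CU] <-].
have /compact_near_coveringP cptC : compact C.
  exact: subclosed_compact cC T_compact _.
have [|n _ /(_ _ (leqnn n)) /= CUn] := cptC _ \oo
    (fun n x => (\bigcup_(i < n) U i) x).
  move=> x /CU [i _ Uix]; exists (U i, [set n | (i < n)%N]) => /=.
    split; first exact: open_nbhs_nbhs.
    by exists i.+1.
  by move=> [y n] /= [Uiy ltin]; exists i.
apply: le_trans (closed_content_le_sum oU cC CUn) _.
rewrite -(big_mkord xpredT (fun i => inner_content (U i))).
by apply: nneseries_lim_ge => *; exact: inner_content_ge0.
Qed.

Lemma outer_content_open U : open U -> outer_content U = inner_content U.
Proof.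
move=> oU; apply/eqP; rewrite eq_le; apply/andP; split.
  by apply: ereal_inf_lbound; exists U => //; split.
by apply: le_ereal_inf_tmp => _ [V [oV UV] <-]; exact: le_inner_content.
Qed.

Lemma outer_content_le_inner A U : open U -> A `<=` U ->
  outer_content A <= inner_content U.
Proof. by move=> oU AU; apply: ereal_inf_lbound; exists U. Qed.

Lemma outer_content_ge0 A : 0 <= outer_content A.
Proof. by apply: le_ereal_inf_tmp => _ [V _ <-]; exact: inner_content_ge0. Qed.

Lemma outer_content_fin_num A : outer_content A \is a fin_num.
Proof.
rewrite ge0_fin_numE ?outer_content_ge0//.
rewrite (le_lt_trans (outer_content_le_inner openT (@subsetT _ A)))//.
by rewrite inner_contentT ltry.
Qed.

Lemma outer_content0 : outer_content set0 = 0.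
Proof.
rewrite outer_content_open; last exact: open0.
apply/eqP; rewrite eq_le inner_content_ge0 andbT.
apply: ge_ereal_sup => _ [C [_ C0] <-].
by move: C0; rewrite subset0 => ->; rewrite closed_content0.
Qed.

Lemma le_outer_content : {homo outer_content : A B / A `<=` B >-> A <= B}.
Proof.
move=> A B AB; apply: le_ereal_inf_tmp => _ [V [oV BV] <-].
by apply: outer_content_le_inner => //; exact: subset_trans BV.
Qed.

Lemma outer_content_sigma_subadditive : sigma_subadditive outer_content.
Proof.
move=> A; apply/lee_addgt0Pr => e e0.
rewrite (le_trans _ (epsilon_trick _ _ _))//; last 2 first.
- by move=> n; exact: outer_content_ge0.
- exact: ltW.
have /choice[U PU] n : exists U, [/\ open U, A n `<=` U &
    inner_content U <= outer_content (A n) + (e / (2 ^ n.+1)%:R)%:E].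
  have en0 : (0 < e / (2 ^ n.+1)%:R)%R by rewrite divr_gt0.
  have [_ [U [oU AU] <-] lU] := lb_ereal_inf_adherent en0
    (outer_content_fin_num (A n)).
  by exists U; split => //; exact: ltW.
have oU n : open (U n) by case: (PU n).
apply: (@le_trans _ _ (inner_content (\bigcup_n U n))).
  apply: outer_content_le_inner; first exact: bigcup_open.
  by apply: subset_bigcup => n _; case: (PU n).
apply: le_trans (inner_content_sigma_subadditive oU) _.
apply: lee_nneseries => [n _ _|n _]; first exact: inner_content_ge0.
by case: (PU n).
Qed.

HB.instance Definition _ := isOuterMeasure.Build R T outer_content
  outer_content0 outer_content_ge0 le_outer_content
  outer_content_sigma_subadditive.

(** Inside an open V, fill V `&` U with a closed C up to epsilon, then the open
    set V `\` C, which contains V `\` U, with a closed E up to epsilon; C and E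
    are disjoint, so their contents add up below that of V. *)
Lemma open_caratheodory U : open U -> outer_content.-caratheodory U.
Proof.
move=> oU; apply: le_caratheodory_measurable => A.
apply: le_ereal_inf_tmp => _ [V [oV AV] <-].
apply: (@le_trans _ _ (inner_content (V `&` U) + outer_content (V `&` ~` U))).
  rewrite leeD//; last by apply: le_outer_content; exact: setSI.
  by apply: outer_content_le_inner; [exact: openI|exact: setSI].
rewrite -leeBrDr ?outer_content_fin_num//.
apply: ge_ereal_sup => _ [C [cC CVU] <-].
rewrite leeBrDr ?outer_content_fin_num// -leeBrDl//.
apply: (@le_trans _ _ (inner_content (V `\` C))).
  apply: outer_content_le_inner; first by apply: openI => //; exact: closed_openC.
  by move=> x [Vx nUx]; split => // /CVU[].
apply: ge_ereal_sup => _ [E [cE EVC] <-].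
rewrite leeBrDl// -EFinD.
apply: le_trans (@inner_content_ge (C `|` E) V _ _); last 2 first.
- exact: closedU.
- by move=> x [/CVU[]|/EVC[]].
rewrite lee_fin (closed_contentU_ge lam_content)//.
by rewrite -subset0 => x [Cx /EVC[]].
Qed.

Lemma borel_caratheodory (A : set (borelType T)) :
  measurable A -> outer_content.-caratheodory A.
Proof.
have sub : (@open T) `<=` (outer_content.-cara.-measurable).
  by move=> U oU; exact: open_caratheodory.
by move=> mA; exact: (smallest_sub (@sigma_algebra_measurable _
  (caratheodory_type outer_content)) sub).
Qed.

Lemma closed_content_probability : lam setT = 1%R ->
  exists mu : probability (borelType T) R, forall U : set (borelType T),
    open (U : set T) -> mu U = inner_content U.
Proof.
move=> lamT.
pose nu : set (borelType T) -> \bar R := outer_content.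
have nu_sigma : semi_sigma_additive nu.
  move=> F mF tF mUF.
  apply: (@caratheodory_measure_sigma_additive R T outer_content) => //.
    by move=> i; exact: borel_caratheodory.
  exact: borel_caratheodory.
have nuT : nu setT = 1.
  by rewrite /nu outer_content_open ?inner_contentT ?lamT//; exact: openT.
pose m1 := isMeasure.Build _ _ _ nu outer_content0 outer_content_ge0 nu_sigma.
pose m2 := Measure_isProbability.Build _ _ _
  (HB.pack_for {measure set (borelType T) -> \bar R} nu m1) nuT.
exists (HB.pack_for (probability (borelType T) R) nu m1 m2) => U oU.
exact: outer_content_open.
Qed.

End ContentMeasure.

(** * Asymptotic density of sets of times *)

Section LebesgueTranslation.
Context {R : realType}.

Definition translation (t : R) : measurableTypeR R -> measurableTypeR R := +%R t.

Let measurable_translation t : measurable_fun setT (translation t).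
Proof.
apply: continuous_measurable_fun => x.
by apply: cvgD; [exact: cvg_cst|exact: cvg_id].
Qed.

Lemma measurable_shift (t : R) (S : set (measurableTypeR R)) :
  measurable S -> measurable (+%R t @^-1` S : set (measurableTypeR R)).
Proof.
by move=> mS; rewrite -[X in measurable X]setTI; exact: measurable_translation.
Qed.

HB.instance Definition _ t :=
  isMeasurableFun.Build _ _ _ _ (translation t) (measurable_translation t).

Lemma lebesgue_measure_translation (t : R) (S : set (measurableTypeR R)) :
  measurable S ->
  lebesgue_measure (+%R t @^-1` S) = lebesgue_measure S.
Proof.
move=> mS; rewrite -[LHS]/(pushforward lebesgue_measure (translation t) S).
apply/esym/lebesgue_measure_unique => //=.
  move=> _ [[a b] _ <-]; rewrite /pushforward/=.
  have -> : translation t @^-1` `]a, b]%classic = `](a - t), (b - t)]%classic.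
    by apply/seteqP; split=> s; rewrite /translation/= !in_itv/= ltrBlDl lerBrDl.
  rewrite !lebesgue_measure_itv/= !lte_fin ltrD2r.
  by case: ifPn => // _; rewrite -!EFinD opprB addrA subrK.
Qed.

End LebesgueTranslation.

Section TimeDensity.
Context {R : realType}.
Set Implicit Arguments.
Unset Strict Implicit.
Implicit Types (S : set (measurableTypeR R)) (n : nat).

(** Ultrafilter limits are additive and exist for all bounded sequences at once;
    this makes the density below finitely additive, with no subsequence to
    extract. *)
Lemma ultrafilter_cvg (G : set_system nat) (u : nat -> R) (a b : R) :
  UltraFilter G -> (forall n, a <= u n <= b) -> cvg (u @ G).
Proof.
move=> UG uab; have PG : ProperFilter (u @ G) by exact: fmap_proper_filter.
have [|p [_ clp]] := @segment_compact R a b (u @ G) PG.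
  by apply: (@filterE _ G) => n; rewrite /= in_itv/= uab.
apply/cvg_ex; exists p => V Vp.
have [//|GnV] := in_ultra_setVsetC (u @^-1` V) UG.
by have [x [nVx Vx]] := clp (~` V) V GnV Vp.
Qed.

Definition time_spent S n : R :=
  fine (lebesgue_measure (S `&` `[0, n.+1%:R]%classic : set (measurableTypeR R))).

Definition time_fraction S n : R := time_spent S n / n.+1%:R.

Let window n : measurable (`[0%R, n.+1%:R]%classic : set (measurableTypeR R)).
Proof. exact: measurable_itv. Qed.

Lemma lebesgue_measure_window n (a : R) :
  lebesgue_measure (`[a, a + n.+1%:R]%classic : set (measurableTypeR R)) =
  n.+1%:R%:E.
Proof.
by rewrite lebesgue_measure_itv/= lte_fin ltrDl ltr0Sn -EFinD addrAC subrr add0r.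
Qed.

Lemma time_spent_fin S n : measurable S ->
  lebesgue_measure (S `&` `[0, n.+1%:R]%classic : set (measurableTypeR R))
  \is a fin_num.
Proof.
move=> mS; rewrite ge0_fin_numE//.
apply: (@le_lt_trans _ _ (lebesgue_measure
   (`[0, 0 + n.+1%:R]%classic : set (measurableTypeR R)))).
  rewrite add0r; apply: le_measure; rewrite ?inE//.
  exact: measurableI.
by rewrite lebesgue_measure_window ltry.
Qed.

Lemma le_time_spent S S' n : measurable S -> measurable S' -> S `<=` S' ->
  time_spent S n <= time_spent S' n.
Proof.
move=> mS mS' SS'; apply: fine_le; [exact: time_spent_fin..|].
apply: le_measure; rewrite ?inE; [exact: measurableI..|exact: setSI].
Qed.

Lemma time_spentT n : time_spent setT n = n.+1%:R.
Proof.
by rewrite /time_spent setTI -[X in `[0%R, X]]add0r lebesgue_measure_window.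
Qed.

Lemma time_spentU S S' n : measurable S -> measurable S' -> S `&` S' = set0 ->
  time_spent (S `|` S') n = time_spent S n + time_spent S' n.
Proof.
move=> mS mS' SS'; rewrite /time_spent setIUl measureU; last 3 first.
- exact: measurableI.
- exact: measurableI.
- by rewrite setIACA SS' set0I.
by rewrite fineD//; exact: time_spent_fin.
Qed.

(** The windows [0, N] and [t, t + N] differ by two intervals of length t. *)
Lemma time_spent_shift S n (t : R) : measurable S -> 0 <= t ->
  `|time_spent (+%R t @^-1` S) n - time_spent S n| <= t.
Proof.
move=> mS t0.
pose N : R := n.+1%:R.
have mtS := measurable_shift t mS.
have mI (a b : R) : measurable (`[a, b]%classic : set (measurableTypeR R)).
  exact: measurable_itv.
pose leb : {measure set (measurableTypeR R) -> \bar R} := lebesgue_measure.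
have shiftE : leb (+%R t @^-1` S `&` `[0, N]%classic) =
    leb (S `&` `[t, t + N]%classic).
  rewrite -[RHS](@lebesgue_measure_translation R t); last exact: measurableI.
  congr (lebesgue_measure _); rewrite preimage_setI; congr (_ `&` _).
  by apply/seteqP; split=> s; rewrite /= !in_itv/= lerDl lerD2l.
have lebI (a : R) : leb `[a, a + t]%classic = t%:E.
  rewrite [LHS]lebesgue_measure_itv/= lte_fin ltrDl.
  case: ltP => [_|t0']; first by rewrite -EFinD addrAC subrr add0r.
  by congr (_%:E); apply/eqP; rewrite eq_le t0 t0'.
rewrite ler_distl; apply/andP; split.
- rewrite lerBlDr -lee_fin EFinD /time_spent !fineK; last 2 first.
  + exact: time_spent_fin.
  + exact: time_spent_fin.
  rewrite -/leb shiftE -[in leRHS](lebI 0) add0r.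
  apply: le_trans (measureU2 leb (measurableI _ _ mS (mI _ _)) (mI _ _)).
  apply: le_measure; rewrite ?inE.
  + exact: measurableI.
  + by apply: measurableU; [exact: measurableI|exact: mI].
  + move=> s [Ss]; rewrite /= !in_itv/= => /andP[s0 sN].
    case: (leP t s) => ts; [left|by right; rewrite s0/= ltW].
    by split => //=; rewrite (le_trans sN)// lerDr.
- rewrite -lee_fin EFinD /time_spent !fineK; last 2 first.
  + exact: time_spent_fin.
  + exact: time_spent_fin.
  rewrite -/leb shiftE -[in leRHS](lebI N).
  apply: le_trans (measureU2 leb (measurableI _ _ mS (mI _ _)) (mI _ _)).
  apply: le_measure; rewrite ?inE.
  + exact: measurableI.
  + by apply: measurableU; [exact: measurableI|exact: mI].
  + move=> s [Ss]; rewrite /= !in_itv/= => /andP[st stN].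
    case: (leP s N) => sN; [left|right].
      by split => //; rewrite (le_trans t0 st).
    by rewrite (ltW sN)/= addrC.
Qed.

Variable G : set_system nat.
Hypothesis UG : UltraFilter G.
Hypothesis ooG : \oo `<=` G.

Definition time_density S : R := lim (time_fraction S n @[n --> G]).

Lemma eq_time_density S S' : (forall s, 0 <= s -> S s <-> S' s) ->
  time_density S = time_density S'.
Proof.
move=> SS'; congr (lim (_ @ G)); apply/funext => n.
congr (fine (lebesgue_measure _) / _).
apply/seteqP; split=> s [Ss]; rewrite /= in_itv/= => /andP[s0 sn];
  by split; [exact/SS'|rewrite s0].
Qed.

Lemma time_fraction_ge0 S n : 0 <= time_fraction S n.
Proof. by rewrite divr_ge0// fine_ge0. Qed.

Lemma time_density_cvg S : measurable S -> cvg (time_fraction S n @[n --> G]).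
Proof.
move=> mS; apply: (@ultrafilter_cvg _ _ 0 1) => // n.
rewrite time_fraction_ge0/= ler_pdivrMr ?ltr0Sn// mul1r -time_spentT.
exact: le_time_spent.
Qed.

Lemma le_time_density S S' : measurable S -> measurable S' -> S `<=` S' ->
  time_density S <= time_density S'.
Proof.
move=> mS mS' SS'; apply: ler_lim; [exact: time_density_cvg..|].
by apply: nearW => n; rewrite ler_pM2r ?invr_gt0 ?ltr0Sn//; exact: le_time_spent.
Qed.

Lemma time_densityU S S' : measurable S -> measurable S' -> S `&` S' = set0 ->
  time_density (S `|` S') = time_density S + time_density S'.
Proof.
move=> mS mS' SS'; rewrite -limD; [|exact: time_density_cvg..].
congr (lim (_ @ G)); apply/funext => n.
by rewrite /time_fraction time_spentU// mulrDl.
Qed.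

Lemma time_densityT : time_density setT = 1.
Proof.
apply: cvg_lim => //; rewrite [X in X @ _](_ : _ = cst 1); first exact: cvg_cst.
by apply/funext => n; rewrite /time_fraction time_spentT divff// pnatr_eq0.
Qed.

(** The error t of a shift is divided by the length of the window. *)
Lemma time_density_shift S (t : R) : measurable S -> 0 <= t ->
  time_density (+%R t @^-1` S) = time_density S.
Proof.
move=> mS t0; apply/eqP; rewrite -subr_eq0.
have mtS := measurable_shift t mS.
rewrite -limB; [|exact: time_density_cvg..].
apply/eqP/cvg_lim => //.
have : (t * (n.+1%:R)^-1) @[n --> \oo] --> (0 : R).
  rewrite -(mulr0 t); apply: cvgM; first exact: cvg_cst.
  exact: cvg_harmonic.
move=> /(cvg_trans _) tn; have {}tn : (t * (n.+1%:R)^-1) @[n --> G] --> (0 : R).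
  by apply: tn => A /ooG.
apply: (@squeeze_cvgr _ _ _ _ (fun n => - (t * n.+1%:R^-1))
  (fun n => t * n.+1%:R^-1)) => //.
  apply: nearW => n; rewrite -ler_norml /time_fraction/= -mulrBl normrM.
  rewrite (@ger0_norm _ n.+1%:R^-1)// ler_pM2r ?invr_gt0 ?ltr0Sn//.
  exact: time_spent_shift.
by rewrite -[X in _ --> X]oppr0; apply: cvgN.
Qed.

End TimeDensity.

(** * Invariant probabilities of continuous semiflows *)

(** Joins the pointed and the topological structures of a product, so that
   the lemmas below apply to the Borel sets of R * X. *)
HB.instance Definition _ (T U : ptopologicalType) := Pointed.on (T * U)%type.

Section BorelMaps.
Set Implicit Arguments.
Unset Strict Implicit.

Lemma open_borel {T : ptopologicalType} (U : set T) :
  open U -> measurable (U : set (borelType T)).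
Proof. by move=> oU; exact: sub_sigma_algebra. Qed.

Lemma closed_borel {T : ptopologicalType} (C : set T) :
  closed C -> measurable (C : set (borelType T)).
Proof.
by move=> /closed_openC/open_borel/measurableC; rewrite setCK.
Qed.

Lemma continuous_borel {T U : ptopologicalType} (f : T -> U) :
  continuous f -> measurable_fun setT (f : borelType T -> borelType U).
Proof.
move=> cf.
apply: (@measurability _ _ (borelType T) (borelType U) setT f (@open U)) => //.
move=> _ [V oV <-]; rewrite setTI; apply: open_borel.
by apply: open_comp => // x _; exact: cf.
Qed.

Lemma measure_eq_open {R : realType} {T : ptopologicalType}
    (mu nu : {measure set (borelType T) -> \bar R}) :
  (mu setT < +oo)%E ->
  (forall U : set T, open U -> mu U = nu U) ->
  forall A, measurable A -> mu A = nu A.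
Proof.
move=> mufin mn A mA.
apply: (@measure_unique _ R (borelType T) (@open T) (fun=> setT)) => //.
- by move=> U V; exact: openI.
- by move=> _; exact: openT.
- by rewrite bigcup_const.
Qed.

End BorelMaps.

Section ContinuousSemiflow.
Context {R : realType} {X : pmetricType R}.
Set Implicit Arguments.
Unset Strict Implicit.
Variable phi : R -> X -> X.
Hypothesis phi_flow : continuous_semiflow phi.

(** Clamping negative times to 0 extends the semiflow to a map that is
    continuous on the whole of R * X. *)
Lemma clamped_flow_continuous :
  continuous (fun p : R * X => phi (Num.max 0 p.1) p.2).
Proof.
move=> p.
pose clamp (q : R * X) : R * X := (Num.max 0 q.1, q.2).
have clampE q : time_domain (clamp q) by rewrite /time_domain/= le_max lexx.
have cclamp1 : (fun q : R * X => Num.max 0 q.1) @ p --> Num.max 0 p.1.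
  apply: (@continuous_comp _ _ _ fst (fun s : R => Num.max 0 s)).
    exact: cvg_fst.
  apply: continuous_max; [exact: cvg_cst|exact: cvg_id].
have cclamp2 : (fun q : R * X => q.2) @ p --> p.2 by exact: cvg_snd.
have cclamp : clamp q @[q --> p] --> clamp p by exact: cvg_pair cclamp1 cclamp2.
have /subspace_continuousP /(_ _ (clampE p)) cphi :=
  continuous_semiflow_continuous phi_flow.
move=> V /cphi => cphiV.
by apply: (@filterS _ (nbhs p) _ _ _ _ (cclamp _ cphiV)) => q /(_ (clampE q)).
Qed.

Lemma flow_continuous (t : R) : 0 <= t -> continuous (phi t).
Proof.
move=> t0 x; have cphi := @clamped_flow_continuous (t, x).
have c1 : (fun=> t) @ x --> t by exact: cvg_cst.
have c2 : id @ x --> x by exact: cvg_id.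
pose F (p : R * X) := phi (Num.max 0 p.1) p.2.
suff <- : F \o (fun y => (t, y)) = phi t.
  apply: (@cvg_comp _ _ _ (fun y : X => (t, y)) F) cphi.
  exact: cvg_pair c1 c2.
by apply/funext => y; rewrite /F/= (max_idPr t0).
Qed.

Lemma orbit_continuous z : continuous (fun s : R => phi (Num.max 0 s) z).
Proof.
move=> s; have c1 : id @ s --> s by exact: cvg_id.
have c2 : (fun=> z) @ s --> z by exact: cvg_cst.
pose F (p : R * X) := phi (Num.max 0 p.1) p.2.
apply: (@cvg_comp _ _ _ (fun r : R => (r, z)) F) (@clamped_flow_continuous (s, z)).
exact: cvg_pair c1 c2.
Qed.

End ContinuousSemiflow.

Section OrbitMeasure.
Context {R : realType} {X : pmetricType R}.
Set Implicit Arguments.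
Unset Strict Implicit.
Hypothesis X_compact : compact [set: X].
Variable phi : R -> X -> X.
Hypothesis phi_flow : continuous_semiflow phi.
Variable G : set_system nat.
Hypothesis UG : UltraFilter G.
Hypothesis ooG : \oo `<=` G.
Variable z : X.

Let orbit (s : R) : X := phi (Num.max 0 s) z.

Definition sojourn_density (A : set X) : R :=
  time_density G (orbit @^-1` A : set (measurableTypeR R)).

Let closed_sojourn C : closed C ->
  measurable (orbit @^-1` C : set (measurableTypeR R)).
Proof.
move=> cC; apply: closed_measurable; apply: preimage_closed => //.
by move=> s _; exact: orbit_continuous.
Qed.

Lemma sojourn_density_content : closed_content sojourn_density.
Proof.
have mE C E : closed C -> closed E ->
    measurable (orbit @^-1` (E `\` C) : set (measurableTypeR R)).
  move=> cC cE; rewrite -[X in measurable X]/(orbit @^-1` E `\` orbit @^-1` C).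
  by apply: measurableD; exact: closed_sojourn.
split.
- have : sojourn_density (set0 `|` set0) = sojourn_density set0 + sojourn_density set0.
    rewrite /sojourn_density preimage_setU time_densityU//.
    + exact: measurable0.
    + exact: measurable0.
    + by rewrite setI0.
  by rewrite setU0 -[LHS]addr0 => /addrI <-.
- move=> C E cC cE CE; apply: le_time_density; [exact: closed_sojourn..|].
  exact: preimage_subset.
- move=> C E cC cE.
  have -> : C `|` E = C `|` (E `\` C).
    by rewrite setDE setUIr setUCr setIT.
  rewrite /sojourn_density preimage_setU time_densityU//.
  + rewrite lerD2l le_time_density//.
    * exact: mE.
    * exact: closed_sojourn.
    * by apply: preimage_subset => x [].
  + exact: closed_sojourn.
  + exact: mE.
  + by rewrite -subset0 => s /= [Cs [_ nCs]].
- move=> C E cC cE CE0; rewrite /sojourn_density preimage_setU time_densityU//.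
  + exact: closed_sojourn.
  + exact: closed_sojourn.
  + by rewrite -preimage_setI CE0 preimage_set0.
Qed.

(** The orbit of z is in phi t @^-1` C at time s when it is in C at time t + s,
    and densities are invariant under shifts. *)
Lemma sojourn_density_flow C (t : R) : closed C -> 0 <= t ->
  sojourn_density (phi t @^-1` C) = sojourn_density C.
Proof.
move=> cC t0; have cCt : closed (phi t @^-1` C).
  by apply: preimage_closed => // x _; exact: flow_continuous.
rewrite -[RHS](@time_density_shift _ _ UG ooG _ t)//; last first.
  exact: closed_sojourn.
apply: eq_time_density => s s0; rewrite /= /orbit.
rewrite (max_idPr s0) (max_idPr (addr_ge0 t0 s0)).
by rewrite (semiflowD (continuous_semiflow_semiflow phi_flow)).
Qed.

(** A Krylov-Bogolyubov theorem for a given orbit. Two Borel probabilities that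
    agree on open sets are equal, so that invariance is checked on an open U:
    a closed C included in U pulls back to a closed subset of phi t @^-1` U,
    and conversely a closed C included in phi t @^-1` U is compact, so that its
    image is a closed subset of U. *)
Lemma orbit_invariant_probability :
  exists mu : probability (borelType X) R,
    (forall (A : set (borelType X)) (t : R), measurable A -> 0 <= t ->
       mu (phi t @^-1` A) = mu A) /\
    (forall U : set X, open U -> (forall s : R, 0 <= s -> ~ U (phi s z)) ->
       mu U = 0%E).
Proof.
have X_haus : hausdorff_space X by exact: metric_hausdorff.
have [|mu muE] := closed_content_probability X_haus X_compact
  sojourn_density_content; first exact: time_densityT.
exists mu; split; last first.
  move=> U oU nU; rewrite muE//; apply/eqP.
  rewrite eq_le (inner_content_ge0 sojourn_density_content) andbT.
  apply: ge_ereal_sup => _ [C [cC CU] <-].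
  rewrite lee_fin -(closed_content0 sojourn_density_content).
  apply: le_time_density => //; [exact: closed_sojourn|exact: measurable0|].
  by move=> s /= /CU; apply: nU; rewrite le_max lexx.
move=> A t mA t0.
have mphi : measurable_fun setT (phi t : borelType X -> borelType X).
  by apply: continuous_borel; exact: flow_continuous.
pose f := mfun_Sub (mem_set mphi).
apply/esym; apply: (@measure_eq_open _ _ mu (pushforward mu f)) => //.
  by rewrite (le_lt_trans (probability_le1 _ _))// ltry.
move=> U oU; rewrite -[RHS]/(mu (phi t @^-1` U)).
have oUt : open (phi t @^-1` U).
  by apply: open_comp => // x _; exact: flow_continuous.
rewrite (muE _ oUt); transitivity (inner_content sojourn_density U).
  exact: muE.
apply/eqP; rewrite eq_le; apply/andP; split.
- apply: ge_ereal_sup => _ [C [cC CU] <-].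
  rewrite -(sojourn_density_flow cC t0); apply: inner_content_ge.
    by apply: preimage_closed => // x _; exact: flow_continuous.
  exact: preimage_subset.
- apply: ge_ereal_sup => _ [C [cC CU] <-].
  have cphiC : closed (phi t @` C).
    apply: compact_closed => //; apply: continuous_compact.
      by apply: continuous_subspaceT; exact: flow_continuous.
    exact: subclosed_compact cC X_compact _.
  apply: (@le_trans _ _ (sojourn_density (phi t @` C))%:E).
    rewrite -(sojourn_density_flow cphiC t0) lee_fin.
    apply: (closed_content_le sojourn_density_content) => //.
      by apply: preimage_closed => // x _; exact: flow_continuous.
    by move=> x Cx; exists x.
  apply: inner_content_ge => // _ [x Cx <-].
  exact: CU.
Qed.

End OrbitMeasure.

(** * The semiflow law for impulsive trajectories *)

Section ImpulsiveTrajectory.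
Context {R : realType} {X : pmetricType R}.
Set Implicit Arguments.
Unset Strict Implicit.
Variables (phi : R -> X -> X) (D : set X) (I : X -> X).
Hypothesis phi_impulsive : impulsive_system phi D I.

Local Notation tau := (hitting_time phi D).
Local Notation time := (impulse_time phi D I).
Local Notation point := (impulse_point phi D I).
Local Notation F := (impulsive_semiflow phi D I).

Let phi_flow : continuous_semiflow phi :=
  impulsive_continuous_semiflow phi_impulsive.

Let phiD (s t : R) x : 0 <= s -> 0 <= t -> phi (t + s) x = phi t (phi s x).
Proof. exact: (semiflowD (continuous_semiflow_semiflow phi_flow)). Qed.

Lemma impulse_set_closed : closed D.
Proof.
apply: compact_closed; first exact: metric_hausdorff.
exact: impulsive_compact phi_impulsive.
Qed.

Lemma hitting_time_gt0 x : (0 < tau x)%E.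
Proof. exact: (impulsive_hitting_time_gt0 phi_impulsive). Qed.

Lemma hitting_time_le x (t : R) : 0 < t -> D (phi t x) -> (tau x <= t%:E)%E.
Proof. by move=> t0 Dt; apply: ereal_inf_lbound; exists t. Qed.

(** A finite hitting time is attained: otherwise, D being closed, the orbit
    would avoid D for a while after that time, which is an infimum. *)
Lemma hitting_time_hits x (r : R) : tau x = r%:E -> D (phi r x).
Proof.
move=> taur; have r0 : 0 < r by rewrite -lte_fin -taur hitting_time_gt0.
apply: contrapT => nDr.
have : nbhs r ((fun s : R => phi (Num.max 0 s) x) @^-1` ~` D).
  apply: (@orbit_continuous R X phi phi_flow x r (~` D)); rewrite (max_idPr (ltW r0)).
  by apply: open_nbhs_nbhs; split => //; exact/closed_openC/impulse_set_closed.
move=> /nbhs_ballP[e /= e0 eD].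
have [|_ [t [t0 Dt] <-] tre] := @ereal_inf_lt _
    [set t%:E | t in [set t : R | 0 < t /\ D (phi t x)]] (r + e)%:E.
  by rewrite -/(tau x) taur lte_fin ltrDl.
apply: (eD t); last by rewrite (max_idPr (ltW t0)).
have rt : r <= t by rewrite -lee_fin -taur hitting_time_le.
by rewrite /ball/= ler0_norm ?subr_le0// opprB ltrBlDl -lte_fin.
Qed.

Lemma hitting_time_eq x (r : R) : 0 < r -> D (phi r x) ->
  (forall t, 0 < t -> t < r -> ~ D (phi t x)) -> tau x = r%:E.
Proof.
move=> r0 Dr nD; apply/eqP; rewrite eq_le hitting_time_le//=.
apply: le_ereal_inf_tmp => _ [t [t0 Dt] <-].
by rewrite lee_fin leNgt; apply/negP => tr; exact: (nD t).
Qed.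

Lemma hitting_time_pinfty x :
  (forall t, 0 < t -> ~ D (phi t x)) -> tau x = +oo%E.
Proof.
move=> nD; apply/eqP; rewrite -leye_eq; apply: le_ereal_inf_tmp => _ [t [t0 Dt] <-].
by have := nD t t0 Dt.
Qed.

Lemma not_hit x (t : R) : 0 < t -> (t%:E < tau x)%E -> ~ D (phi t x).
Proof. by move=> t0 ttau /(hitting_time_le t0); rewrite leNgt ttau. Qed.

Lemma hitting_time_flow x (s : R) : 0 <= s -> (s%:E < tau x)%E ->
  tau (phi s x) = (tau x - s%:E)%E.
Proof.
move=> s0 staux; case taur : (tau x) => [r| |].
- have sr : s < r by rewrite -lte_fin -taur.
  rewrite -EFinB; apply: hitting_time_eq; first by rewrite subr_gt0.
    rewrite -phiD//; last by rewrite subr_ge0 ltW.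
    by rewrite subrK; exact: hitting_time_hits.
  move=> t t0 trs; rewrite -phiD ?(ltW t0)//; apply: not_hit.
    exact: ltr_wpDr.
  by rewrite taur lte_fin -ltrBrDr.
- apply: hitting_time_pinfty => t t0; rewrite -phiD ?(ltW t0)//.
  by apply: not_hit; [exact: ltr_wpDr|rewrite taur ltry].
- by have := hitting_time_gt0 x; rewrite taur.
Qed.

Lemma le_impulse_timeS n x : (time n x <= time n.+1 x)%E.
Proof. by rewrite /= leeDl// ltW// hitting_time_gt0. Qed.

Lemma le_impulse_time m n x : (m <= n)%N -> (time m x <= time n x)%E.
Proof.
elim: n => [|n IHn]; first by rewrite leqn0 => /eqP ->.
rewrite leq_eqVlt => /predU1P[->//|]; rewrite ltnS => /IHn.
by move=> /le_trans; apply; exact: le_impulse_timeS.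
Qed.

Lemma impulse_time_ge0 n x : (0 <= time n x)%E.
Proof. exact: (@le_impulse_time 0). Qed.

Lemma impulse_time_fin n x (t : R) : (time n x <= t%:E)%E ->
  time n x \is a fin_num.
Proof.
move=> nt; rewrite ge0_fin_numE ?impulse_time_ge0//.
by rewrite (le_lt_trans nt)// ltry.
Qed.

Definition between_impulses n x (t : R) : bool :=
  (time n x <= t%:E < time n.+1 x)%E.

Lemma between_impulses_ex x (t : R) : 0 <= t -> exists n, between_impulses n x t.
Proof.
move=> t0.
have exn : exists n, (t%:E < time n.+1 x)%E.
  have [|_ [n _ <-] tn] := @ereal_sup_gt _ (range (fun n => time n.+1 x)) t%:E.
    by rewrite (impulsive_time_sup phi_impulsive) ltry.
  by exists n.
exists (ex_minn exn); case: ex_minnP => n tn minn.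
rewrite /between_impulses tn andbT; case: n tn minn => [_ _|n _ minn].
  by rewrite lee_fin.
by rewrite leNgt; apply/negP => /minn; rewrite ltnn.
Qed.

Lemma between_impulses_inj m n x (t : R) :
  between_impulses m x t -> between_impulses n x t -> m = n.
Proof.
wlog mn : m n / (m <= n)%N.
  by move=> wl; case/orP: (leq_total m n) => [|/wl nm ? ?]; [exact: wl|exact/esym/nm].
move=> /andP[_ tm] /andP[nt _]; apply/eqP; rewrite eqn_leq mn/= leqNgt.
apply/negP => /(@le_impulse_time _ _ x) => mn'.
by have := lt_le_trans tm (le_trans mn' nt); rewrite ltxx.
Qed.

Lemma impulsive_semiflowE n x (t : R) : between_impulses n x t ->
  F t x = phi (t - fine (time n x)) (point n x).
Proof.
move=> nt; rewrite /impulsive_semiflow.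
case: xgetP => [_ _ [m mt <-]|/(_ (phi (t - fine (time n x)) (point n x)))].
  by rewrite (between_impulses_inj mt nt).
by case; exists n.
Qed.

Lemma impulsive_semiflow_flow x (t : R) : 0 <= t -> (t%:E < tau x)%E ->
  F t x = phi t x.
Proof.
move=> t0 ttau; rewrite (@impulsive_semiflowE 0) ?subr0//.
by rewrite /between_impulses/= lee_fin t0 add0e.
Qed.

Section Restart.
Variables (n : nat) (x : X) (s : R).
Hypothesis ns : between_impulses n x s.

Let a := fine (time n x).

Let timeE : time n x = a%:E.
Proof. by case/andP: ns => /impulse_time_fin fn _; rewrite /a fineK. Qed.

Let sa0 : 0 <= s - a.
Proof. by case/andP: ns => + _; rewrite timeE lee_fin subr_ge0. Qed.

Let sa_tau : ((s - a)%:E < tau (point n x))%E.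
Proof. by case/andP: ns => _; rewrite /= timeE EFinB lteBlDl. Qed.

Let tau_restart : tau (F s x) = (tau (point n x) - (s - a)%:E)%E.
Proof. by rewrite (impulsive_semiflowE ns) hitting_time_flow. Qed.

(** Restarting the trajectory of x at a time s between the n-th impulse and the
    next one translates the remaining impulsive times by - s and leaves the
    corresponding positions unchanged. The 0-th time and position
    of the restarted trajectory are those of F s x itself, hence the k.+1. *)
Lemma impulse_restart k :
  time k.+1 (F s x) = (time (n + k).+1 x - s%:E)%E /\
  (time k.+1 (F s x) \is a fin_num ->
   point k.+1 (F s x) = point (n + k).+1 x).
Proof.
elim: k => [|k [IHt IHp]].
- rewrite addn0 /= add0e timeE tau_restart.
  have := hitting_time_gt0 (point n x).
  case taur : (tau (point n x)) => [r| |]// _.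
    have sar : s - a <= r by rewrite ltW// -lte_fin -taur.
    split; first by rewrite -!EFinB; congr (_%:E); ring.
    have flow_r : phi (r - (s - a)) (phi (s - a) (point n x)) = phi r (point n x).
      by rewrite -phiD//; [rewrite subrK|rewrite subr_ge0].
    by move=> _; rewrite (impulsive_semiflowE ns) -/a /= flow_r.
- rewrite addnS; split; last first.
    move=> fk.
    have fk' : time k.+1 (F s x) \is a fin_num.
      rewrite ge0_fin_numE ?impulse_time_ge0//.
      rewrite (le_lt_trans (le_impulse_timeS _ _))//.
      by rewrite -ge0_fin_numE ?impulse_time_ge0.
    by rewrite -[LHS]/(I (phi (fine (tau (point k.+1 (F s x)))) (point k.+1 (F s x))))
      (IHp fk').
  rewrite -[LHS]/(time k.+1 (F s x) + tau (point k.+1 (F s x)))%E.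
  rewrite -[time (n + k).+2 x]/(time (n + k).+1 x + tau (point (n + k).+1 x))%E.
  have [fk|] := boolP (time k.+1 (F s x) \is a fin_num).
    by rewrite (IHp fk) IHt addeAC.
  rewrite ge0_fin_numE ?impulse_time_ge0// ltey negbK => /eqP tk.
  rewrite tk; have -> : time (n + k).+1 x = +oo%E.
    by move: IHt; rewrite tk; case: (time (n + k).+1 x).
  by rewrite !addye// gt_eqF// (lt_trans _ (hitting_time_gt0 _)).
Qed.

End Restart.

Lemma impulsive_semiflowD (s t : R) x : 0 <= s -> 0 <= t ->
  F (t + s) x = F t (F s x).
Proof.
move=> s0 t0.
have [n ns] := between_impulses_ex x s0.
have [k kt] := between_impulses_ex (F s x) t0.
case: k kt => [|k] kt; case/andP: (kt) => kt1 kt2.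
- have fn : time n x \is a fin_num by case/andP: (ns) => /impulse_time_fin.
  have sn : 0 <= s - fine (time n x).
    by case/andP: (ns) => + _; rewrite -{1}(fineK fn) lee_fin subr_ge0.
  rewrite (impulsive_semiflowE kt) subr0 /= (impulsive_semiflowE ns) -phiD// addrA.
  apply: impulsive_semiflowE; rewrite /between_impulses.
  case/andP: (ns) => ns1 ns2; rewrite (le_trans ns1) ?lee_fin ?lerDr//=.
  by move: kt2; rewrite (impulse_restart ns 0).1 addn0 lteBrDr.
- have [tE pE] := impulse_restart ns k.
  have [tE' _] := impulse_restart ns k.+1.
  have fk := impulse_time_fin kt1.
  have fnk : time (n + k).+1 x \is a fin_num.
    by move: fk; rewrite tE fin_numB => /andP[].
  rewrite (impulsive_semiflowE kt) (pE fk) tE fineB// opprB addrA.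
  apply: impulsive_semiflowE; rewrite /between_impulses EFinD.
  by move: kt1 kt2; rewrite tE tE' leeBlDr// lteBrDr// addnS => -> ->.
Qed.

End ImpulsiveTrajectory.

(** * Borel measurability of the impulsive semiflow *)

Section BorelPair.
Context {R : realType} {X : ptopologicalType}.
Set Implicit Arguments.
Unset Strict Implicit.

(** The Borel sets of the product R * X are those generated by rectangles:
    an open U is the countable union of the rectangles whose first side is an
    interval ]q1, q2[ with rational ends and whose second side is the largest
    open set W such that ]q1, q2[ `*` W `<=` U. It is second countability of R
    alone that makes the union countable. *)
Lemma measurable_fun_pair_borel d (T : measurableType d) (E : set T)
    (s : T -> measurableTypeR R) (y : T -> borelType X) :
  measurable_fun E s -> measurable_fun E y ->
  measurable_fun E ((fun w => (s w, y w)) : T -> borelType (R * X)%type).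
Proof.
move=> ms my mE.
apply: (@measurability _ _ T (borelType (R * X)%type) E _
  (@open (R * X)%type)) => // _ [U oU <-].
pose W (q : rat * rat) : set X :=
  interior [set x | forall r : R, ratr q.1 < r < ratr q.2 -> U (r, x)].
have -> : E `&` (fun w => (s w, y w)) @^-1` U =
    \bigcup_(q in [set: rat * rat])
      ((E `&` s @^-1` `]ratr q.1, ratr q.2[%classic) `&` (E `&` y @^-1` W q)).
  apply/seteqP; split=> [w [Ew Uw]|w [q _ [[Ew sw] [_ yw]]]]; last first.
    split => //; apply: (interior_subset yw).
    by move: sw; rewrite /= in_itv.
  have : nbhs (s w : R, y w : X) U by apply: open_nbhs_nbhs; split.
  move=> [[A B] /= [As By] ABU].
  have /nbhs_ballP[e /= e0 eA] := As.
  have [q1 /[!in_itv]/= /andP[eq1 q1s]] :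
      exists q, ratr q \in `](s w : R) - e, (s w : R)[.
    by apply: rat_in_itvoo; rewrite ltrBlDr ltrDl.
  have [q2 /[!in_itv]/= /andP[sq2 q2e]] :
      exists q, ratr q \in `](s w : R), (s w : R) + e[.
    by apply: rat_in_itvoo; rewrite ltrDl.
  exists (q1, q2) => //; split; split => //=; first by rewrite in_itv/= q1s.
  apply: filterS By => x Bx r /andP[q1r rq2].
  apply: (ABU (r, x)); split => //=; apply: eA.
  rewrite /ball/= ltr_distlC.
  by rewrite (lt_trans eq1 q1r) (lt_trans rq2 q2e).
apply: countable_bigcupT_measurable => // q; apply: measurableI.
  by apply: ms => //; exact: measurable_itv.
by apply: my => //; apply: open_borel; exact: open_interior.
Qed.

Lemma continuous_borel_real (f : X -> R) :
  continuous f -> measurable_fun setT (f : borelType X -> measurableTypeR R).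
Proof.
move=> cf; apply: (measurability _ (RGenOpens.measurableE R)).
move=> _ [_ [a [b ->] <-]]; rewrite setTI; apply: open_borel.
by apply: open_comp => [x _|]; [exact: cf|exact: interval_open].
Qed.

End BorelPair.

Lemma time_domain_borel {R : realType} {X : pmetricType R} :
  measurable (time_domain : set (borelType (R * X)%type)).
Proof.
apply: (@closed_borel (R * X)%type).
rewrite (_ : time_domain = fst @^-1` `[0, +oo[%classic); last first.
  by apply/seteqP; split=> p; rewrite /time_domain/= in_itv/= andbT.
apply: preimage_closed; first by move=> p _; exact: cvg_fst.
exact: interval_closed.
Qed.

Section ImpulsiveMeasurability.
Context {R : realType} {X : pmetricType R}.
Set Implicit Arguments.
Unset Strict Implicit.
Variables (phi : R -> X -> X) (D : set X) (I : X -> X).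
Hypothesis X_compact : compact [set: X].
Hypothesis phi_impulsive : impulsive_system phi D I.

Local Notation tau := (hitting_time phi D).
Local Notation time := (impulse_time phi D I).
Local Notation point := (impulse_point phi D I).
Local Notation F := (impulsive_semiflow phi D I).

Let phi_flow : continuous_semiflow phi :=
  impulsive_continuous_semiflow phi_impulsive.

(** The projection of a closed subset of the compact [a, b] * X. *)
Lemma hits_within_closed (a b : R) : 0 <= a ->
  closed [set x | exists2 s, a <= s <= b & D (phi s x)].
Proof.
move=> a0; pose g (p : R * X) := phi (Num.max 0 p.1) p.2.
pose K : set (R * X) := (`[a, b]%classic `*` setT) `&` g @^-1` D.
have cK : compact K.
  apply: compact_closedI.
    by apply: compact_setX => //; exact: segment_compact.
  apply: preimage_closed; first by move=> p _; exact: clamped_flow_continuous.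
  exact: impulse_set_closed phi_impulsive.
rewrite [X in closed X](_ : _ = snd @` K).
  apply: compact_closed; first exact: metric_hausdorff.
  apply: continuous_compact => //.
  by apply: continuous_subspaceT => p; exact: cvg_snd.
apply/seteqP; split=> x.
  move=> [s /andP[as_ sb] Ds]; exists (s, x) => //; split => /=.
    by rewrite in_itv/= as_ sb.
  by rewrite /g/= (max_idPr (le_trans a0 as_)).
move=> [[s y] [[/= + _] /= gD] <-]; rewrite in_itv/= => /andP[as_ sb].
move: gD; rewrite /g/= (max_idPr (le_trans a0 as_)) => Ds.
by exists s => //; rewrite as_.
Qed.

(** As hitting times are infima over positive times, tau x < a means that x
    hits D within [1 / k.+1, a - 1 / k.+1] for some k. *)
Lemma measurable_hitting_time :
  measurable_fun setT (tau : borelType X -> \bar R).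
Proof.
apply: (measurability _ (ErealGenInftyO.measurableE R)) => _ [_ [a ->] <-].
rewrite setTI.
pose A k : set X := [set x | exists2 s : R,
  k.+1%:R^-1 <= s <= a - k.+1%:R^-1 & D (phi s x)].
rewrite (_ : _ @^-1` _ = \bigcup_k A k); last first.
  apply/seteqP; split=> x.
    rewrite /= in_itv/= => /ereal_inf_lt[_ [s [s0 Ds] <-]]; rewrite lte_fin => sa.
    have [k ks] : exists k, k.+1%:R^-1 < Num.min s (a - s).
      have [k _ /(_ _ (leqnn k))/= kl] : \forall k \near \oo,
          `|0 - k.+1%:R^-1| < Num.min s (a - s).
        have /cvgrPdist_lt := @cvg_harmonic R.
        by apply; rewrite lt_min s0 subr_gt0.
      by exists k; move: kl; rewrite sub0r normrN ger0_norm.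
    move: ks; rewrite lt_min => /andP[ks kas].
    exists k => //; exists s => //; rewrite (ltW ks)/=.
    by rewrite lerBrDl -lerBrDr ltW.
  move=> [k _ [s /andP[ks sk] Ds]]; rewrite /= in_itv/=.
  have k0 : 0 < k.+1%:R^-1 :> R by rewrite invr_gt0.
  apply: (@le_lt_trans _ _ s%:E).
    by apply: hitting_time_le => //; exact: lt_le_trans ks.
  by rewrite lte_fin (le_lt_trans sk)// ltrBlDr ltrDl.
apply: bigcupT_measurable => k; apply: closed_borel.
by apply: hits_within_closed; rewrite invr_ge0.
Qed.

Lemma measurable_impulse : measurable_fun (D : set (borelType X))
  (I : borelType X -> borelType X).
Proof.
have cD := impulse_set_closed phi_impulsive.
move=> mD; apply: (@measurability _ _ (borelType X) (borelType X) D I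
  (@open X)) => // _ [U oU <-].
have /continuousP /(_ _ oU) := impulsive_continuous phi_impulsive.
move=> /open_subspaceP[V oV VE].
rewrite setIC -VE; apply: measurableI => //; exact: open_borel.
Qed.

Lemma measurable_clamped_flow d (T : measurableType d) (E : set T)
    (s : T -> measurableTypeR R) (y : T -> borelType X) :
  measurable_fun E s -> measurable_fun E y ->
  measurable_fun E ((fun w => phi (Num.max 0 (s w)) (y w)) : T -> borelType X).
Proof.
move=> ms my; pose g (p : R * X) := phi (Num.max 0 p.1) p.2.
have mg : measurable_fun setT (g : borelType (R * X)%type -> borelType X).
  exact: (@continuous_borel _ _ g (clamped_flow_continuous phi_flow)).
exact: (measurableT_comp mg (measurable_fun_pair_borel ms my)).
Qed.

Let finite_time n : set (borelType X) := [set x | (time n x < +oo)%E].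

(** The positions are measurable only where the corresponding times are finite:
    elsewhere they involve values of the impulse map outside D, on which
    nothing is assumed. *)
Lemma measurable_impulse_sequence n :
  measurable_fun setT (time n : borelType X -> \bar R) /\
  measurable_fun (finite_time n) (point n : borelType X -> borelType X).
Proof.
elim: n => [|n [mt mp]].
  by split=> [|/=]; [exact: measurable_cst|exact: measurable_id].
have mfin k : measurable_fun setT (time k : borelType X -> \bar R) ->
    measurable (finite_time k).
  move=> mk; rewrite -[finite_time k]setTI.
  by apply: measurable_lte => //; exact: measurable_cst.
have mtau : measurable_fun (finite_time n)
    ((fun x => tau (point n x)) : borelType X -> \bar R).
  exact: (measurableT_comp measurable_hitting_time mp).
have mtS : measurable_fun setT (time n.+1 : borelType X -> \bar R).
  rewrite -(setUv (finite_time n)).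
  apply/measurable_funU; [exact: mfin|by apply: measurableC; exact: mfin|split].
    by apply: emeasurable_funD => //; exact: measurable_funTS.
  apply: (@eq_measurable_fun _ _ _ _ _ (cst +oo%E)); last exact: measurable_cst.
  move=> x; rewrite inE/= /finite_time/= ltey => /negP/negPn/eqP => tx.
  by rewrite /= tx addye// gt_eqF// (lt_trans _ (hitting_time_gt0 phi_impulsive _)).
split => //.
have sub : finite_time n.+1 `<=` finite_time n.
  move=> x /=; apply: le_lt_trans; exact: le_impulse_timeS.
have tau_fin x : finite_time n.+1 x -> (tau (point n x) < +oo)%E.
  rewrite /finite_time/=; apply: le_lt_trans; rewrite leeDr//.
  exact: impulse_time_ge0.
pose h (x : X) := phi (Num.max 0 (fine (tau (point n x)))) (point n x).
have hE x : finite_time n.+1 x ->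
    h x = phi (fine (tau (point n x))) (point n x) /\ D (h x).
  move=> /tau_fin; have := hitting_time_gt0 phi_impulsive (point n x).
  rewrite /h; case taux : (tau (point n x)) => [r| |]//= r0 _.
  rewrite (max_idPr _); last by rewrite ltW// -lte_fin.
  by split => //; exact: (hitting_time_hits phi_impulsive).
have mh : measurable_fun (finite_time n.+1) (h : borelType X -> borelType X).
  apply: measurable_clamped_flow; last exact: measurable_funS (mfin n mt) sub mp.
  apply: (measurableT_comp (fine_measurable measurableT)).
  exact: measurable_funS (mfin n mt) sub mtau.
apply: (@eq_measurable_fun _ _ (borelType X) (borelType X) _ (I \o h)).
  by move=> x; rewrite inE => /hE[/= -> _].
apply: (measurable_comp (F := D : set (borelType X))) mh.
- exact: closed_borel (impulse_set_closed phi_impulsive).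
- by move=> _ [x /hE[_ Dh] <-].
- exact: measurable_impulse.
Qed.

(** The domain of times is the countable union of the sets J n of the (t, x)
    such that t lies between the n-th impulse of x and the next one. *)
Lemma impulsive_semiflow_measurable :
  borel_measurable_semiflow F.
Proof.
pose Y := borelType (R * X)%type.
have mfst : measurable_fun setT (fst : Y -> measurableTypeR R).
  by apply: (@continuous_borel_real _ (R * X)%type) => p; exact: cvg_fst.
have msnd : measurable_fun setT (snd : Y -> borelType X).
  by apply: (@continuous_borel (R * X)%type X) => p; exact: cvg_snd.
pose J n : set Y := time_domain `&`
  ([set p | (time n p.2 <= p.1%:E)%E] `&` [set p | (p.1%:E < time n.+1 p.2)%E]).
have mdom : measurable (time_domain : set Y) by exact: time_domain_borel.
have mtime n : measurable_fun setT ((fun p => time n p.2) : Y -> \bar R).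
  exact: (measurableT_comp (measurable_impulse_sequence n).1 msnd).
have mE : measurable_fun setT ((fun p => p.1%:E) : Y -> \bar R).
  exact/measurable_EFinP.
have mJ n : measurable (J n).
  apply: measurableI => //; apply: measurableI.
    by rewrite -[X in measurable X]setTI; exact: measurable_lee.
  by rewrite -[X in measurable X]setTI; exact: measurable_lte.
have domE : (time_domain : set Y) = \bigcup_n J n.
  apply/seteqP; split=> [p p0|p [n _ []//]].
  have [n /andP[np pn]] := between_impulses_ex phi_impulsive p.2 p0.
  by exists n.
rewrite /borel_measurable_semiflow -/Y domE.
apply/measurable_fun_bigcup => // n.
pose s (p : Y) : measurableTypeR R := p.1 - fine (time n p.2).
pose y (p : Y) : borelType X := point n p.2.
apply: (@eq_measurable_fun _ _ Y (borelType X) _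
  (fun p => phi (Num.max 0 (s p)) (y p))).
  move=> p; rewrite inE => -[p0 [np pn]].
  rewrite (@impulsive_semiflowE _ _ _ _ _ phi_impulsive n) ?/between_impulses ?np//.
  rewrite (max_idPr _)// subr_ge0 -lee_fin fineK//.
  exact: impulse_time_fin np.
apply: measurable_clamped_flow.
  apply: measurable_funB; first exact: measurable_funTS.
  apply: measurable_funTS.
  exact: (measurableT_comp (fine_measurable measurableT) (mtime n)).
apply: (measurable_comp (F := finite_time n)) (measurable_funTS msnd).
- rewrite -[finite_time n]setTI; apply: measurable_lte => //.
  exact: (measurable_impulse_sequence n).1.
- by move=> _ [p [_ [np _]] <-]; rewrite /finite_time/= (le_lt_trans np)// ltry.
- exact: (measurable_impulse_sequence n).2.
Qed.

End ImpulsiveMeasurability.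

(** * Wandering impulse sets and invariant measures *)

Section NonImpulsiveOrbit.
Context {R : realType} {X : pmetricType R}.
Set Implicit Arguments.
Unset Strict Implicit.
Variables (phi : R -> X -> X) (D : set X) (I : X -> X).
Hypothesis phi_impulsive : impulsive_system phi D I.
Hypothesis nonwandering_D :
  nonwandering (impulsive_semiflow phi D I) `&` D = set0.

Local Notation tau := (hitting_time phi D).
Local Notation F := (impulsive_semiflow phi D I).

Let phi_flow : continuous_semiflow phi :=
  impulsive_continuous_semiflow phi_impulsive.

Let tail (x : X) (T : R) : set X := [set F t x | t in [set t | T <= t]].

(** Two visits to U separated by more than the delay of non-return are
    impossible, so that the orbit is out of U from any visit plus that delay
    on. *)
Lemma wandering_eventually_left (x d : X) : D d ->
  exists2 U, open_nbhs d U & exists2 T, 0 <= T & forall t, T <= t -> ~ U (F t x).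
Proof.
move=> Dd.
have : ~ nonwandering F d.
  by move=> nd; have : set0 d by rewrite -nonwandering_D.
move=> /existsNP[U /not_implyP[+ /existsNP[T /not_implyP[T0 nU]]]].
rewrite nbhsE => -[V dV VU].
exists V => //.
have [[s s0 Vs]|nV] := pselect (exists2 s, 0 <= s & V (F s x)); last first.
  by exists 0 => // t t0 Vt; apply: nV; exists t.
exists (T + s) => [|t Tst Vt]; first by rewrite addr_ge0// ltW.
apply: nU; exists (t - s); split; first by rewrite lerBrDr.
exists (F s x); split; last exact: VU.
rewrite /= -(impulsive_semiflowD phi_impulsive)//.
  by rewrite subrK; exact: VU.
by rewrite subr_ge0 (le_trans _ Tst)// lerDr ltW.
Qed.

Lemma impulse_set_avoids_tail x : exists2 T, 0 <= T & D `<=` ~` closure (tail x T).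
Proof.
have /compact_near_coveringP cptD := impulsive_compact phi_impulsive.
have := cptD _ (+oo%R : set_system R) (fun T y => (~` closure (tail x T)) y) _.
move=> /(_ _)[|T [_ +]]; last first.
  move=> /(_ (Num.max 0 (T + 1))) DT; exists (Num.max 0 (T + 1)).
    by rewrite le_max lexx.
  by apply: DT; rewrite lt_max ltrDl ltr01 orbT.
move=> d /(wandering_eventually_left x)[U [oU Ud] [T T0 nU]].
exists (U, [set t | T <= t]) => /=.
  by split; [exact: open_nbhs_nbhs|exact: nbhs_pinfty_ge (num_real T)].
move=> [y t] /= [Uy Tt] /(_ U)[|_ [[r tr <-] Ur]]; first exact: open_nbhs_nbhs.
by apply: (nU r) => //; exact: le_trans tr.
Qed.

(** Impulses are preceded by visits to every neighborhood of D, because the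
    trajectory is continuous up to the impulse and its left limit is in D. *)
Lemma orbit_avoiding_impulses (x : X) : exists (z : X) (W : set X),
  [/\ open W, D `<=` W & forall t, 0 <= t -> ~ W (phi t z)].
Proof.
have [T T0 DT] := impulse_set_avoids_tail x.
pose W := ~` closure (tail x T).
have oW : open W by apply: closed_openC; exact: closed_closure.
have tailNW t : T <= t -> ~ W (F t x).
  by move=> Tt; apply; apply: subset_closure; exists t.
pose z := F T x.
have Fz t : 0 <= t -> ~ W (F t z).
  move=> t0; rewrite /z -(impulsive_semiflowD phi_impulsive)//.
  by apply: tailNW; rewrite lerDr.
exists z, W; split => //.
suff tauz : tau z = +oo%E.
  move=> t t0; rewrite -(impulsive_semiflow_flow phi_impulsive) ?tauz ?ltry//.
  exact: Fz.
case tauz : (tau z) => [r| |]//; last first.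
  by have := hitting_time_gt0 phi_impulsive z; rewrite tauz.
have r0 : 0 < r by rewrite -lte_fin -tauz (hitting_time_gt0 phi_impulsive).
have : nbhs r ((fun s : R => phi (Num.max 0 s) z) @^-1` W).
  apply: (@orbit_continuous R X phi phi_flow z r W); rewrite (max_idPr (ltW r0)).
  apply: open_nbhs_nbhs; split => //; apply: DT.
  exact: (hitting_time_hits phi_impulsive).
move=> /nbhs_ballP[e /= e0 eW].
(* A time before the impulse, close enough to r for phi s z to be in W. *)
pose s := Num.max 0 (r - e / 2).
have s0 : 0 <= s by rewrite le_max lexx.
have sr : s < r by rewrite gt_max r0 ltrBlDr ltrDl divr_gt0.
exfalso; apply: (Fz s) => //.
rewrite (impulsive_semiflow_flow phi_impulsive) ?tauz ?lte_fin//.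
rewrite -[X in phi X](max_idPr s0); apply: eW.
rewrite /ball/= ger0_norm ?subr_ge0 1?ltW//.
rewrite ltrBlDr -ltrBlDl lt_max; apply/orP; right.
by rewrite ltrD2l ltrN2 ltr_pdivrMr// ltr_pMr// ltr1n.
Qed.

End NonImpulsiveOrbit.

Theorem corollary3 (R : realType) (X : pmetricType R)
    (phi : R -> X -> X) (D : set X) (I : X -> X)
    (X_compact : compact [set: X])
    (phi_impulsive : impulsive_system phi D I)
    (nonwandering_D : nonwandering (impulsive_semiflow phi D I) `&` D = set0) :
  exists mu : probability (borelType X) R,
    invariant_measure (impulsive_semiflow phi D I) mu.
Proof.
have phi_flow := impulsive_continuous_semiflow phi_impulsive.
have [z [W [oW DW zW]]] := orbit_avoiding_impulses phi_impulsive nonwandering_D point.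
have [G [UG ooG]] := ultraFilterLemma (eventually_filter : ProperFilter \oo).
have [mu [mu_inv mu0]] := orbit_invariant_probability X_compact phi_flow UG ooG z.
exists mu; split; first exact: impulsive_semiflow_measurable.
(* The points whose phi-orbit enters W; the other ones never meet D. *)
pose O : set X := \bigcup_(t in [set t : R | 0 <= t]) phi t @^-1` W.
have oO : open O.
  apply: bigcup_open => t t0; apply: open_comp => // x _.
  exact: flow_continuous.
have muO : mu O = 0%E.
  apply: mu0 => // s s0 [t t0]; rewrite /= -(semiflowD
    (continuous_semiflow_semiflow phi_flow))//.
  by apply: zW; exact: addr_ge0.
have FE t x : 0 <= t -> ~ O x -> impulsive_semiflow phi D I t x = phi t x.
  move=> t0 nO; apply: (impulsive_semiflow_flow phi_impulsive) => //.
  rewrite hitting_time_pinfty ?ltry// => s s0 /DW Ws.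
  by apply: nO; exists s => //=; exact: ltW.
have mO : measurable (O : set (borelType X)) by exact: open_borel.
have muD (B : set (borelType X)) : measurable B -> mu B = mu (B `\` O).
  move=> mB; rewrite measureD//; last first.
    by rewrite (le_lt_trans (probability_le1 mu mB))// ltry.
  rewrite [X in (_ - X)%E](_ : _ = 0%E) ?sube0//.
  by apply: measure_negligible; [exact: measurableI|exists O; split].
move=> A t mA t0.
have m_slice : measurable_fun setT
    ((fun x => (t, x)) : borelType X -> borelType (R * X)%type).
  by apply: measurable_fun_pair_borel; [exact: measurable_cst|exact: measurable_id].
have mFA : measurable (impulsive_semiflow phi D I t @^-1` A : set (borelType X)).
  have mF := impulsive_semiflow_measurable X_compact phi_impulsive.
  rewrite -[X in measurable X]setTI.
  apply: (measurable_comp time_domain_borel _ mF m_slice) => //.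
  by move=> _ [x _ <-].
have mphiA : measurable (phi t @^-1` A : set (borelType X)).
  rewrite -[X in measurable X]setTI.
  by apply: (continuous_borel (flow_continuous phi_flow t0)).
rewrite -(mu_inv A t mA t0) (muD _ mFA) (muD _ mphiA); congr (mu _).
by apply/seteqP; split=> x [/= Ax nOx]; split => //=; move: Ax; rewrite FE.
Qed.
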